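(* Let $\mathsf{C}$ be a strict braided monoidal category and let $(H,\gamma_H,T_H)$ be a brace triple in $\mathsf{C}$ with $H$ finite. Then the morphism $\alpha_H=(H^*\otimes\gamma_H)\circ(c_{H,H^*}\otimes H)\circ(H\otimes a_H):H\to H^*\otimes H$ is invertible for the convolution in $\mathrm{Hom}(H,H^*\otimes H)$, with inverse $\beta_H=\alpha_H\circ T_H^{-1}$; that is, $$(H^*\otimes b_H\otimes H)\circ(\alpha_H\otimes\beta_H)\circ\delta_H=\varepsilon_H\otimes a_H=(H^*\otimes b_H\otimes H)\circ(\beta_H\otimes\alpha_H)\circ\delta_H.$$
   Context: $\mathsf{C}$ is a strict braided monoidal category with tensor product $\otimes$, unit object $K$ and braiding $c$ (not assumed symmetric). For an object $P$ and a morphism $f$, $P\otimes f$ means $id_P\otimes f$ and $f\otimes P$ means $f\otimes id_P$. Algebras, coalgebras, bialgebras and Hopf algebras are internal to $\mathsf{C}$; the tensor product of coalgebras $D,E$ has coproduct $(D\otimes c_{D,E}\otimes E)\circ(\delta_D\otimes\delta_E)$ and counit $\varepsilon_D\otimes\varepsilon_E$, and the tensor product of algebras $A,B$ has product $(\mu_A\otimes\mu_B)\circ(A\otimes c_{B,A}\otimes B)$. A Hopf algebra $H=(H,\eta_H,\mu_H,\varepsilon_H,\delta_H,\lambda_H)$ is a bialgebra with a morphism (antipode) $\lambda_H$ such that $\mu_H\circ(H\otimes\lambda_H)\circ\delta_H=\eta_H\circ\varepsilon_H=\mu_H\circ(\lambda_H\otimes H)\circ\delta_H$. An object $P$ is finite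 if there is an object $P^*$ (its dual) and a $\mathsf{C}$-adjunction $P\otimes-\dashv P^*\otimes-$; the unit and counit evaluated at $K$ are morphisms $a_P:K\to P^*\otimes P$ and $b_P:P\otimes P^*\to K$ with $(b_P\otimes P)\circ(P\otimes a_P)=id_P$ and $(P^*\otimes b_P)\circ(a_P\otimes P^* )=id_{P^*}$. Then $P^*\otimes P$ is an algebra with product $P^*\otimes b_P\otimes P$ and unit $a_P$; convolution in $\mathrm{Hom}(H,H^*\otimes H)$ is with respect to this algebra and the coalgebra $(H,\varepsilon_H,\delta_H)$. Brace triple: $(H,\gamma_H,T_H)$ with $H=(H,\eta_H,\mu_H,\varepsilon_H,\delta_H,\lambda_H)$ a Hopf algebra in $\mathsf{C}$ with $\lambda_H$ an isomorphism, and morphisms $\gamma_H:H\otimes H\to H$, $T_H:H\to H$ such that (i) $(\gamma_H\otimes H)\circ(H\otimes c_{H,H})\circ(\delta_H\otimes H)=(\gamma_H\otimes H)\circ(H\otimes c_{H,H})\circ((c_{H,H}\circ\delta_H)\otimes H)$; (ii) $\gamma_H$ is a coalgebra morphism; (iii) $\gamma_H\circ(H\otimes\mu_H)=\mu_H\circ(\gamma_H\otimes\gamma_H)\circ(H\otimes c_{H,H}\otimes H)\circ(\delta_H\otimes H\otimes H)$; (iv) $\gamma_H\circ(H\otimes\gamma_H)=\gamma_H\circ((\mu_H\circ(H\otimes\gamma_H)\circ(\delta_H\otimes H))\otimes H)$; (v) $\gamma_H\circ(\eta_H\otimes H)=id_H$; (vi) $T_H$ is an isomorphism with (vi.1) $\delta_H\circ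 T_H=c_{H,H}\circ(T_H\otimes T_H)\circ\delta_H$, (vi.2) $\varepsilon_H\circ T_H=\varepsilon_H$, (vi.3) $\mu_H\circ(H\otimes\gamma_H)\circ((\delta_H\circ T_H)\otimes H)=\mu_H\circ(H\otimes\gamma_H)\circ(((T_H\otimes T_H)\circ\delta_H)\otimes H)$, (vi.4) $\gamma_H\circ(H\otimes T_H)\circ\delta_H=\lambda_H$, (vi.5) $\gamma_H\circ(T_H\otimes H)\circ\delta_H=\lambda_H^{-1}\circ T_H$. *)

(* Defs.v *)
Set Implicit Arguments.
Unset Strict Implicit.
Unset Printing Implicit Defensive.

Declare Scope cat_scope.
Delimit Scope cat_scope with cat.
Local Open Scope cat_scope.

(** Strict braided monoidal categories, in arrows-only style: there is one type
    of morphisms, with source and target maps.  Since the strictness equations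
    hold between objects, this makes [(f ⊗ g) ⊗ h = f ⊗ (g ⊗ h)] a plain
    equality, with no transport.  Composition is a total function which is
    constrained only on composable pairs; typing of a morphism is expressed by
    [is_hom]. *)
Record strict_braided_cat := StrictBraidedCat {
  Ob : Type;
  Mor : Type;
  src : Mor -> Ob;
  tgt : Mor -> Ob;
  idm : Ob -> Mor;
  comp : Mor -> Mor -> Mor;            (* [comp g f] is g after f *)
  src_idm : forall A, src (idm A) = A;
  tgt_idm : forall A, tgt (idm A) = A;
  src_comp : forall g f, tgt f = src g -> src (comp g f) = src f;
  tgt_comp : forall g f, tgt f = src g -> tgt (comp g f) = tgt g;
  comp_assoc : forall h g f, tgt f = src g -> tgt g = src h ->
    comp h (comp g f) = comp (comp h g) f;
  comp_idl : forall f, comp (idm (tgt f)) f = f;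
  comp_idr : forall f, comp f (idm (src f)) = f;

  unitob : Ob;
  tensO : Ob -> Ob -> Ob;
  tens : Mor -> Mor -> Mor;
  src_tens : forall f g, src (tens f g) = tensO (src f) (src g);
  tgt_tens : forall f g, tgt (tens f g) = tensO (tgt f) (tgt g);
  tens_idm : forall A B, tens (idm A) (idm B) = idm (tensO A B);
  tens_comp : forall g f g' f', tgt f = src g -> tgt f' = src g' ->
    tens (comp g f) (comp g' f') = comp (tens g g') (tens f f');
  tensOA : forall A B C, tensO A (tensO B C) = tensO (tensO A B) C;
  tensO1l : forall A, tensO unitob A = A;
  tensO1r : forall A, tensO A unitob = A;
  tensA : forall f g h, tens f (tens g h) = tens (tens f g) h;
  tens1l : forall f, tens (idm unitob) f = f;
  tens1r : forall f, tens f (idm unitob) = f;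

  braid : Ob -> Ob -> Mor;
  braid_inv : Ob -> Ob -> Mor;
  src_braid : forall A B, src (braid A B) = tensO A B;
  tgt_braid : forall A B, tgt (braid A B) = tensO B A;
  src_braid_inv : forall A B, src (braid_inv A B) = tensO B A;
  tgt_braid_inv : forall A B, tgt (braid_inv A B) = tensO A B;
  braidK : forall A B, comp (braid_inv A B) (braid A B) = idm (tensO A B);
  braid_invK : forall A B, comp (braid A B) (braid_inv A B) = idm (tensO B A);
  braid_nat : forall f g,
    comp (braid (tgt f) (tgt g)) (tens f g)
    = comp (tens g f) (braid (src f) (src g));
  braid_tensr : forall A B C,
    braid A (tensO B C)
    = comp (tens (idm B) (braid A C)) (tens (braid A B) (idm C));
  braid_tensl : forall A B C,
    braid (tensO A B) C
    = comp (tens (braid A C) (idm B)) (tens (idm A) (braid B C))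
}.

Arguments unitob {_}.

(** An object used as a morphism denotes its identity. *)
Coercion idm : Ob >-> Mor.

Notation "A ⊠ B" := (tensO A B) (at level 34, left associativity) : cat_scope.
Notation "f ⊗ g" := (tens f g) (at level 34, left associativity) : cat_scope.
Notation "g ∘ f" := (comp g f) (at level 40, left associativity) : cat_scope.

Definition is_hom (C : strict_braided_cat) (A B : Ob C) (f : Mor C) : Prop :=
  src f = A /\ tgt f = B.

Record is_inverse (C : strict_braided_cat) (A B : Ob C) (f g : Mor C) : Prop :=
  IsInverse {
  inverse_hom : is_hom A B f;
  inverse_inv_hom : is_hom B A g;
  inverse_l : g ∘ f = idm A;
  inverse_r : f ∘ g = idm B
}.

Record alg_data (C : strict_braided_cat) := AlgData {
  alg_obj :> Ob C;
  alg_unit : Mor C;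
  alg_mul : Mor C
}.

Record is_algebra (C : strict_braided_cat) (A : alg_data C) : Prop := IsAlgebra {
  alg_unit_hom : is_hom unitob A (alg_unit A);
  alg_mul_hom : is_hom (A ⊠ A) A (alg_mul A);
  alg_mulA : alg_mul A ∘ (A ⊗ alg_mul A) = alg_mul A ∘ (alg_mul A ⊗ A);
  alg_mul1l : alg_mul A ∘ (alg_unit A ⊗ A) = idm A;
  alg_mul1r : alg_mul A ∘ (A ⊗ alg_unit A) = idm A
}.

Record coalg_data (C : strict_braided_cat) := CoalgData {
  coalg_obj :> Ob C;
  coalg_counit : Mor C;
  coalg_comul : Mor C
}.

Record is_coalgebra (C : strict_braided_cat) (D : coalg_data C) : Prop :=
  IsCoalgebra {
  coalg_counit_hom : is_hom D unitob (coalg_counit D);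
  coalg_comul_hom : is_hom D (D ⊠ D) (coalg_comul D);
  coalg_comulA :
    (D ⊗ coalg_comul D) ∘ coalg_comul D = (coalg_comul D ⊗ D) ∘ coalg_comul D;
  coalg_comul1l : (coalg_counit D ⊗ D) ∘ coalg_comul D = idm D;
  coalg_comul1r : (D ⊗ coalg_counit D) ∘ coalg_comul D = idm D
}.

Record is_alg_morphism (C : strict_braided_cat) (A B : alg_data C) (f : Mor C) :
  Prop := IsAlgMorphism {
  alg_morphism_hom : is_hom A B f;
  alg_morphism_unit : f ∘ alg_unit A = alg_unit B;
  alg_morphism_mul : f ∘ alg_mul A = alg_mul B ∘ (f ⊗ f)
}.

Record is_coalg_morphism (C : strict_braided_cat) (D E : coalg_data C)
  (f : Mor C) : Prop := IsCoalgMorphism {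
  coalg_morphism_hom : is_hom D E f;
  coalg_morphism_counit : coalg_counit E ∘ f = coalg_counit D;
  coalg_morphism_comul : coalg_comul E ∘ f = (f ⊗ f) ∘ coalg_comul D
}.

Definition unit_alg (C : strict_braided_cat) : alg_data C :=
  AlgData unitob (idm unitob) (idm unitob).

Definition tens_alg (C : strict_braided_cat) (A B : alg_data C) : alg_data C :=
  AlgData (A ⊠ B) (alg_unit A ⊗ alg_unit B)
    ((alg_mul A ⊗ alg_mul B) ∘ (A ⊗ braid B A ⊗ B)).

Definition tens_coalg (C : strict_braided_cat) (D E : coalg_data C) :
  coalg_data C :=
  CoalgData (D ⊠ E) (coalg_counit D ⊗ coalg_counit E)
    ((D ⊗ braid D E ⊗ E) ∘ (coalg_comul D ⊗ coalg_comul E)).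

Record hopf_algebra (C : strict_braided_cat) := HopfAlgebra {
  hopf_obj :> Ob C;
  eta : Mor C;
  mu : Mor C;
  eps : Mor C;
  delta : Mor C;
  lambda : Mor C;
  hopf_is_algebra : is_algebra (AlgData hopf_obj eta mu);
  hopf_is_coalgebra : is_coalgebra (CoalgData hopf_obj eps delta);
  eps_alg_morphism :
    is_alg_morphism (AlgData hopf_obj eta mu) (unit_alg C) eps;
  delta_alg_morphism :
    is_alg_morphism (AlgData hopf_obj eta mu)
      (tens_alg (AlgData hopf_obj eta mu) (AlgData hopf_obj eta mu)) delta;
  lambda_hom : is_hom hopf_obj hopf_obj lambda;
  antipode_r : mu ∘ (hopf_obj ⊗ lambda) ∘ delta = eta ∘ eps;
  antipode_l : mu ∘ (lambda ⊗ hopf_obj) ∘ delta = eta ∘ eps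
}.

Definition hopf_coalg (C : strict_braided_cat) (H : hopf_algebra C) :
  coalg_data C := CoalgData H (eps H) (delta H).

(** The inverses of [lambda H] and [T] are part of the data; they are determined
    by the [is_inverse] conditions. *)
Record is_brace_triple (C : strict_braided_cat) (H : hopf_algebra C)
  (lambda_inv gamma T T_inv : Mor C) : Prop := IsBraceTriple {
  lambda_iso : is_inverse H H (lambda H) lambda_inv;
  gamma_cocommutative :
    (gamma ⊗ H) ∘ (H ⊗ braid H H) ∘ (delta H ⊗ H)
    = (gamma ⊗ H) ∘ (H ⊗ braid H H) ∘ ((braid H H ∘ delta H) ⊗ H);
  gamma_coalg_morphism :
    is_coalg_morphism (tens_coalg (hopf_coalg H) (hopf_coalg H)) (hopf_coalg H)
      gamma;
  gamma_mu :
    gamma ∘ (H ⊗ mu H)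
    = mu H ∘ (gamma ⊗ gamma) ∘ (H ⊗ braid H H ⊗ H) ∘ (delta H ⊗ H ⊗ H);
  gamma_gamma :
    gamma ∘ (H ⊗ gamma)
    = gamma ∘ ((mu H ∘ (H ⊗ gamma) ∘ (delta H ⊗ H)) ⊗ H);
  gamma_eta : gamma ∘ (eta H ⊗ H) = idm H;
  T_iso : is_inverse H H T T_inv;
  delta_T : delta H ∘ T = braid H H ∘ (T ⊗ T) ∘ delta H;
  eps_T : eps H ∘ T = eps H;
  mu_gamma_delta_T :
    mu H ∘ (H ⊗ gamma) ∘ ((delta H ∘ T) ⊗ H)
    = mu H ∘ (H ⊗ gamma) ∘ (((T ⊗ T) ∘ delta H) ⊗ H);
  gamma_T_r : gamma ∘ (H ⊗ T) ∘ delta H = lambda H;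
  gamma_T_l : gamma ∘ (T ⊗ H) ∘ delta H = lambda_inv ∘ T
}.

Record brace_triple (C : strict_braided_cat) := BraceTriple {
  brace_hopf :> hopf_algebra C;
  gamma : Mor C;
  T : Mor C;
  lambda_inv : Mor C;
  T_inv : Mor C;
  brace_tripleP : is_brace_triple brace_hopf lambda_inv gamma T T_inv
}.

(** A [C]-adjunction [P ⊗ - ⊣ Q ⊗ -]: unit and counit are natural, satisfy the
    triangle identities, and are compatible with the action of [C] on itself by
    tensoring on the right, for which [P ⊗ -] and [Q ⊗ -] are strict
    [C]-functors. *)
Record c_adjunction (C : strict_braided_cat) (P Q : Ob C) := CAdjunction {
  adj_unit : Ob C -> Mor C;
  adj_counit : Ob C -> Mor C;
  adj_unit_hom : forall X, is_hom X (Q ⊠ (P ⊠ X)) (adj_unit X);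
  adj_counit_hom : forall X, is_hom (P ⊠ (Q ⊠ X)) X (adj_counit X);
  adj_unit_nat : forall X Y f, is_hom X Y f ->
    (Q ⊗ (P ⊗ f)) ∘ adj_unit X = adj_unit Y ∘ f;
  adj_counit_nat : forall X Y f, is_hom X Y f ->
    f ∘ adj_counit X = adj_counit Y ∘ (P ⊗ (Q ⊗ f));
  adj_triangle_l : forall X,
    adj_counit (P ⊠ X) ∘ (P ⊗ adj_unit X) = idm (P ⊠ X);
  adj_triangle_r : forall X,
    (Q ⊗ adj_counit X) ∘ adj_unit (Q ⊠ X) = idm (Q ⊠ X);
  adj_unit_tens : forall X Y, adj_unit (X ⊠ Y) = adj_unit X ⊗ Y;
  adj_counit_tens : forall X Y, adj_counit (X ⊠ Y) = adj_counit X ⊗ Y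
}.

Record finite (C : strict_braided_cat) (P : Ob C) := Finite {
  dual : Ob C;
  finite_adj : c_adjunction P dual
}.

Definition coev (C : strict_braided_cat) (P : Ob C) (F : finite P) : Mor C :=
  adj_unit (finite_adj F) unitob.

Definition ev (C : strict_braided_cat) (P : Ob C) (F : finite P) : Mor C :=
  adj_counit (finite_adj F) unitob.

Lemma coev_hom (C : strict_braided_cat) (P : Ob C) (F : finite P) :
  is_hom unitob (dual F ⊠ P) (coev F).
Proof.
  destruct (adj_unit_hom (finite_adj F) unitob) as [Hs Ht].
  split; [exact Hs | unfold coev; rewrite Ht, tensO1r; reflexivity].
Qed.

Lemma ev_hom (C : strict_braided_cat) (P : Ob C) (F : finite P) :
  is_hom (P ⊠ dual F) unitob (ev F).
Proof.
  destruct (adj_counit_hom (finite_adj F) unitob) as [Hs Ht].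
  split; [unfold ev; rewrite Hs, tensO1r; reflexivity | exact Ht].
Qed.

Lemma ev_coev_l (C : strict_braided_cat) (P : Ob C) (F : finite P) :
  (ev F ⊗ P) ∘ (P ⊗ coev F) = idm P.
Proof.
  pose proof (adj_triangle_l (finite_adj F) unitob) as E.
  unfold ev, coev; rewrite <- adj_counit_tens, tensO1l.
  rewrite tensO1r in E; exact E.
Qed.

Lemma ev_coev_r (C : strict_braided_cat) (P : Ob C) (F : finite P) :
  (dual F ⊗ ev F) ∘ (coev F ⊗ dual F) = idm (dual F).
Proof.
  pose proof (adj_triangle_r (finite_adj F) unitob) as E.
  unfold ev, coev; rewrite <- adj_unit_tens, tensO1l.
  rewrite tensO1r in E; exact E.
Qed.

Definition end_alg (C : strict_braided_cat) (P : Ob C) (F : finite P) :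
  alg_data C :=
  AlgData (dual F ⊠ P) (coev F) (dual F ⊗ ev F ⊗ P).

Definition conv (C : strict_braided_cat) (D : coalg_data C) (A : alg_data C)
  (f g : Mor C) : Mor C := alg_mul A ∘ (f ⊗ g) ∘ coalg_comul D.

Record is_conv_inverse (C : strict_braided_cat) (D : coalg_data C)
  (A : alg_data C) (f g : Mor C) : Prop := IsConvInverse {
  conv_inverse_hom : is_hom D A f;
  conv_inverse_inv_hom : is_hom D A g;
  conv_inverse_r : conv D A f g = alg_unit A ∘ coalg_counit D;
  conv_inverse_l : conv D A g f = alg_unit A ∘ coalg_counit D
}.

Definition alpha (C : strict_braided_cat) (H : brace_triple C) (F : finite H) :
  Mor C :=
  (dual F ⊗ gamma H) ∘ (braid H (dual F) ⊗ H) ∘ (H ⊗ coev F).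

Definition beta (C : strict_braided_cat) (H : brace_triple C) (F : finite H) :
  Mor C := alpha F ∘ T_inv H.

(* Main.v *)
(** Uncurrying a morphism [X -> P* ⊗ P] along the duality turns it into an action
    [P ⊗ X -> P], and convolution into composition of actions; the action of
    [alpha], precomposed with the braiding, is [gamma].  By (iv), the two
    convolutions of [alpha] and [beta = alpha ∘ T^-1], evaluated on [T], become
    the actions through [gamma] of [μ (H ⊗ γ) (δ ⊗ T) δ] and
    [μ (H ⊗ γ) (δT ⊗ H) δ].  The first equals [μ (H ⊗ λ) δ] by (vi.4), hence is
    [η ε].  By (vi.3) and (vi.5) the second equals [μ (H ⊗ λ^-1) (T ⊗ T) δ], and
    since the antipode is an antimorphism of algebras, composing with [λ] gives
    [μ (H ⊗ λ) δ T = η ε] by (vi.1). *)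
From Stdlib Require Import List Arith Lia.
Import ListNotations.
Require Import Defs.

Local Open Scope cat_scope.
Local Open Scope list_scope.

(** * Typing *)

Section Typing.
Context {C : strict_braided_cat}.
Implicit Types (f g : Mor C).

Lemma idm_hom (A : Ob C) : is_hom A A (idm A).
Proof. split; [apply src_idm | apply tgt_idm]. Qed.

Lemma comp_hom A B D f g : is_hom A B f -> is_hom B D g -> is_hom A D (g ∘ f).
Proof.
  intros [sf tf] [sg tg].
  split; [rewrite src_comp | rewrite tgt_comp]; congruence.
Qed.

Lemma tens_hom A B A' B' f g :
  is_hom A B f -> is_hom A' B' g -> is_hom (A ⊠ A') (B ⊠ B') (f ⊗ g).
Proof.
  intros [sf tf] [sg tg].
  split; [rewrite src_tens | rewrite tgt_tens]; congruence.
Qed.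

Lemma braid_hom (A B : Ob C) : is_hom (A ⊠ B) (B ⊠ A) (braid A B).
Proof. split; [apply src_braid | apply tgt_braid]. Qed.

Lemma braid_inv_hom (A B : Ob C) : is_hom (B ⊠ A) (A ⊠ B) (braid_inv A B).
Proof. split; [apply src_braid_inv | apply tgt_braid_inv]. Qed.

Lemma hom_idl A B f : is_hom A B f -> B ∘ f = f.
Proof. intros [_ <-]; apply comp_idl. Qed.

Lemma hom_idr A B f : is_hom A B f -> f ∘ A = f.
Proof. intros [<- _]; apply comp_idr. Qed.

Lemma hom_assoc A B D E f g h :
  is_hom A B f -> is_hom B D g -> is_hom D E h -> h ∘ (g ∘ f) = h ∘ g ∘ f.
Proof. intros [? ?] [? ?] [? ?]; apply comp_assoc; congruence. Qed.

Lemma hom_interchange A B D A' B' D' f g f' g' :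
  is_hom A B f -> is_hom B D g -> is_hom A' B' f' -> is_hom B' D' g' ->
  (g ∘ f) ⊗ (g' ∘ f') = (g ⊗ g') ∘ (f ⊗ f').
Proof. intros [? ?] [? ?] [? ?] [? ?]; apply tens_comp; congruence. Qed.

End Typing.

(** * Normal forms for the interchange law *)

Section Diagrams.
Context {C : strict_braided_cat}.

Definition obj (l : list (Ob C)) : Ob C := fold_right (@tensO C) unitob l.

Lemma obj_app l m : obj (l ++ m) = obj l ⊠ obj m.
Proof.
  induction l as [|A l IH]; cbn; [symmetry; apply tensO1l|].
  fold (obj l) (obj (l ++ m)); rewrite IH; apply tensOA.
Qed.

(** One generator between identity strands. Its source and target are kept as lists of strands, so
    that positions in a diagram can be compared by computing lengths. *)
Record layer := Layer {
  left : list (Ob C);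
  gen : Mor C;
  inp : list (Ob C);
  out : list (Ob C);
  right : list (Ob C)
}.

Definition layer_mor (x : layer) : Mor C :=
  obj (left x) ⊗ gen x ⊗ obj (right x).

Definition layer_src (x : layer) := left x ++ inp x ++ right x.
Definition layer_tgt (x : layer) := left x ++ out x ++ right x.
Arguments layer_src : simpl never.
Arguments layer_tgt : simpl never.
Arguments layer_mor : simpl never.

Lemma layer_hom x : is_hom (obj (inp x)) (obj (out x)) (gen x) ->
  is_hom (obj (layer_src x)) (obj (layer_tgt x)) (layer_mor x).
Proof.
  intros Hx; unfold layer_src, layer_tgt; rewrite !obj_app, !tensOA.
  repeat apply tens_hom; try apply idm_hom; exact Hx.
Qed.

Fixpoint path (s : list (Ob C)) (ls : list layer) (t : list (Ob C)) : Prop :=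
  match ls with
  | [] => s = t
  | x :: ls' => s = layer_src x /\ is_hom (obj (inp x)) (obj (out x)) (gen x) /\
      path (layer_tgt x) ls' t
  end.

Fixpoint eval (s : list (Ob C)) (ls : list layer) : Mor C :=
  match ls with
  | [] => obj s
  | x :: ls' => eval (layer_tgt x) ls' ∘ layer_mor x
  end.

Lemma eval_hom s ls t : path s ls t -> is_hom (obj s) (obj t) (eval s ls).
Proof.
  revert s; induction ls as [|x ls IH]; intros s; cbn.
  - intros ->; apply idm_hom.
  - intros (-> & Hx & Hls).
    exact (comp_hom _ _ _ _ _ (layer_hom x Hx) (IH _ Hls)).
Qed.

Lemma path_app s ls t ms u :
  path s ls t -> path t ms u -> path s (ls ++ ms) u.
Proof.
  revert s; induction ls as [|x ls IH]; intros s; cbn; [intros ->; auto|].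
  intros (Hs & Hx & Hls) Hms; auto.
Qed.

Lemma eval_app s ls t ms u : path s ls t -> path t ms u ->
  eval s (ls ++ ms) = eval t ms ∘ eval s ls.
Proof.
  revert s; induction ls as [|x ls IH]; intros s; cbn.
  - intros -> Hms; symmetry; apply (hom_idr _ _ _ (eval_hom _ _ _ Hms)).
  - intros (-> & Hx & Hls) Hms; rewrite (IH _ Hls Hms); symmetry.
    exact (hom_assoc _ _ _ _ _ _ _ (layer_hom x Hx) (eval_hom _ _ _ Hls)
             (eval_hom _ _ _ Hms)).
Qed.

Definition whisker (l r : list (Ob C)) (x : layer) : layer :=
  Layer (l ++ left x) (gen x) (inp x) (out x) (right x ++ r).

Lemma whisker_src l r x : layer_src (whisker l r x) = l ++ layer_src x ++ r.
Proof. unfold layer_src; cbn; rewrite <- !app_assoc; reflexivity. Qed.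

Lemma whisker_tgt l r x : layer_tgt (whisker l r x) = l ++ layer_tgt x ++ r.
Proof. unfold layer_tgt; cbn; rewrite <- !app_assoc; reflexivity. Qed.

Lemma path_whisker l r s ls t :
  path s ls t -> path (l ++ s ++ r) (map (whisker l r) ls) (l ++ t ++ r).
Proof.
  revert s; induction ls as [|x ls IH]; intros s; cbn; [congruence|].
  intros (-> & Hx & Hls); rewrite whisker_src, whisker_tgt; auto.
Qed.

(** Tensoring with fixed identities is functorial: interchange on the left and on the right splits
    each composite. *)
Lemma eval_whisker l r s ls t : path s ls t ->
  eval (l ++ s ++ r) (map (whisker l r) ls) = obj l ⊗ eval s ls ⊗ obj r.
Proof.
  revert s; induction ls as [|x ls IH]; intros s; cbn.
  - intros _; rewrite !tens_idm, !obj_app, tensOA; reflexivity.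
  - intros (-> & Hx & Hls); rewrite whisker_tgt, (IH _ Hls).
    assert (Hm : layer_mor (whisker l r x) = obj l ⊗ layer_mor x ⊗ obj r).
    { unfold layer_mor; cbn; rewrite !obj_app, <- !tens_idm, !tensA.
      reflexivity. }
    pose proof (layer_hom x Hx) as H1; pose proof (eval_hom _ _ _ Hls) as H2.
    rewrite Hm.
    rewrite <- (hom_interchange _ _ _ _ _ _ _ _ _ _
      (tens_hom _ _ _ _ _ _ (idm_hom (obj l)) H1)
      (tens_hom _ _ _ _ _ _ (idm_hom (obj l)) H2) (idm_hom _) (idm_hom _)).
    rewrite <- (hom_interchange _ _ _ _ _ _ _ _ _ _ (idm_hom (obj l))
      (idm_hom _) H1 H2).
    rewrite !(hom_idl _ _ _ (idm_hom _)); reflexivity.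
Qed.

(** * Sorting layers by the interchange law *)

Definition fits (x y : layer) : bool :=
  length (left y) + length (inp y) <=? length (left x).

(* When [y] only touches strands to the left of the output of [x], it can be
   performed before [x]. *)
Definition slide_first (x y : layer) : layer :=
  Layer (left y) (gen y) (inp y) (out y)
    (skipn (length (left y) + length (inp y)) (left x) ++ inp x ++ right x).

Definition slide_second (x y : layer) : layer :=
  Layer (left y ++ out y ++
      skipn (length (left y) + length (inp y)) (left x))
    (gen x) (inp x) (out x) (right x).

(** Insertion step of a sort that performs generators further to the left earlier: [x] is delayed
    until the first layer that cannot slide past it. *)
Fixpoint insert (x : layer) (ls : list layer) : list layer :=
  match ls with
  | [] => [x]
  | y :: ls' => if fits x y
      then slide_first x y :: insert (slide_second x y) ls'
      else x :: ls
  end.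

Fixpoint sort (ls : list layer) : list layer :=
  match ls with [] => [] | x :: ls' => insert x (sort ls') end.

Lemma app_prefix (A : Type) (l m l' m' : list A) : l ++ m = l' ++ m' ->
  length l' <= length l -> l = l' ++ skipn (length l') l /\
    m' = skipn (length l') l ++ m.
Proof.
  revert l; induction l' as [|a l' IH]; intros [|b l]; cbn; intros E L;
    try (split; congruence); try lia.
  injection E as -> E; destruct (IH l E) as [E1 E2]; [lia|].
  split; [f_equal|]; assumption.
Qed.

(** By interchange both sides equal [obj l ⊗ y ⊗ obj m ⊗ x ⊗ obj r]; [m] is the block of strands
    between the two generators. *)
Lemma slide_mor l m r (x y : Mor C) a b d e :
  is_hom (obj a) (obj b) x -> is_hom (obj d) (obj e) y ->
  (obj l ⊗ y ⊗ obj (m ++ b ++ r)) ∘ (obj (l ++ d ++ m) ⊗ x ⊗ obj r)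
  = (obj (l ++ e ++ m) ⊗ x ⊗ obj r) ∘ (obj l ⊗ y ⊗ obj (m ++ a ++ r)).
Proof.
  intros Hx Hy; rewrite !obj_app, <- !tens_idm, !tensA.
  assert (Hm := idm_hom (obj m)); assert (Hl := idm_hom (obj l)).
  assert (Hr := idm_hom (obj r)).
  repeat (erewrite <- !hom_interchange; cycle 1;
    try (repeat (eassumption || apply tens_hom || apply idm_hom))).
  rewrite !(hom_idl _ _ _ (idm_hom _)), (hom_idl _ _ _ Hx), (hom_idl _ _ _ Hy),
    (hom_idr _ _ _ Hx), (hom_idr _ _ _ Hy).
  reflexivity.
Qed.

Lemma slide_correct x y t : fits x y = true ->
  path (layer_src x) [x; y] t ->
  path (layer_src x) [slide_first x y; slide_second x y] t /\
  layer_mor (slide_second x y) ∘ layer_mor (slide_first x y)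
  = layer_mor y ∘ layer_mor x.
Proof.
  destruct x as [l1 f1 s1 t1 r1], y as [l2 f2 s2 t2 r2]; cbn.
  unfold fits, slide_first, slide_second, layer_mor, layer_src, layer_tgt; cbn.
  intros L%Nat.leb_le (_ & Hx & E & Hy & <-).
  rewrite <- length_app in L; rewrite (app_assoc l2) in E.
  (* Since [y] fits, [l2 ++ s2] is a prefix of [l1]; the remainder of [l1] is the block between the
     two generators. *)
  destruct (app_prefix _ _ _ _ _ E L) as [E1 E2].
  rewrite <- !length_app; set (m := skipn _ _) in *.
  rewrite E1, E2, <- !app_assoc; repeat split; try apply Hx; try apply Hy.
  symmetry; apply slide_mor; assumption.
Qed.

Lemma insert_correct x ls s t : path s (x :: ls) t ->
  path s (insert x ls) t /\ eval s (insert x ls) = eval s (x :: ls).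
Proof.
  revert x s; induction ls as [|y ls IH]; intros x s Hp; [auto|].
  cbn [insert]; destruct (fits x y) eqn:L; [|auto].
  destruct Hp as (-> & Hx & Ey & Hy & Hls).
  destruct (slide_correct x y (layer_tgt y) L) as [(E1 & H1 & E2 & H2 & E3) E].
  { cbn; auto. }
  destruct (IH (slide_second x y) (layer_tgt (slide_first x y))) as [Hi Ei].
  { cbn; rewrite E3; auto. }
  split; [cbn; auto|].
  cbn [eval]; rewrite Ei; cbn [eval].
  pose proof (layer_hom _ H1) as h1; pose proof (layer_hom _ H2) as h2.
  pose proof (layer_hom _ Hx) as h3; pose proof (layer_hom _ Hy) as h4.
  pose proof (eval_hom _ _ _ Hls) as h5.
  rewrite <- Ey in h4; rewrite E2 in h1; rewrite E3 in h2 |- *.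
  rewrite <- (hom_assoc _ _ _ _ _ _ _ h3 h4 h5).
  rewrite <- (hom_assoc _ _ _ _ _ _ _ h1 h2 h5), E; reflexivity.
Qed.

Lemma sort_correct s ls t : path s ls t ->
  path s (sort ls) t /\ eval s (sort ls) = eval s ls.
Proof.
  revert s; induction ls as [|x ls IH]; intros s Hp; [auto|].
  destruct Hp as (E & Hx & Hls); destruct (IH _ Hls) as [H1 H2].
  cbn [sort]; destruct (insert_correct x (sort ls) s t) as [H3 H4].
  { cbn; auto. }
  split; [exact H3|rewrite H4; cbn; rewrite H2; reflexivity].
Qed.

(** * Reification of morphisms as lists of layers *)

Definition reifies (f : Mor C) s ls t := path s ls t /\ f = eval s ls.

Lemma reifies_idm A s : A = obj s -> reifies (idm A) s [] s.
Proof. intros ->; split; reflexivity. Qed.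

Lemma reifies_gen A B f s t : is_hom A B f -> A = obj s -> B = obj t ->
  reifies f s [Layer [] f s t []] t.
Proof.
  intros Hf -> ->; split; cbn; unfold layer_src, layer_tgt; cbn;
    rewrite !app_nil_r; [auto|].
  unfold layer_mor; cbn; rewrite tens1l, tens1r.
  symmetry; apply (hom_idl _ _ _ Hf).
Qed.

Lemma reifies_comp f g s t t' u ls ms : reifies f s ls t ->
  reifies g t' ms u -> t = t' -> reifies (g ∘ f) s (ls ++ ms) u.
Proof.
  intros [Hf ->] [Hg ->] <-; split; [eapply path_app; eassumption|].
  symmetry; eapply eval_app; eassumption.
Qed.

(** The tensor product is sequentialised: [f] acts beside the source of [g], then [g] beside the
    target of [f]. *)
Lemma reifies_tens f g s t s' t' ls ms : reifies f s ls t -> reifies g s' ms t' ->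
  reifies (f ⊗ g) (s ++ s') (map (whisker [] s') ls ++ map (whisker t []) ms)
    (t ++ t').
Proof.
  intros [Hf ->] [Hg ->].
  pose proof (path_whisker [] s' _ _ _ Hf) as H1.
  pose proof (path_whisker t [] _ _ _ Hg) as H2.
  pose proof (eval_whisker [] s' _ _ _ Hf) as E1.
  pose proof (eval_whisker t [] _ _ _ Hg) as E2.
  rewrite !app_nil_r in *; cbn [app obj fold_right] in *.
  split; [eapply path_app; eassumption|].
  rewrite (eval_app _ _ _ _ _ H1 H2), E1, E2; cbn; rewrite tens1l, tens1r.
  pose proof (eval_hom _ _ _ Hf) as h1; pose proof (eval_hom _ _ _ Hg) as h2.
  rewrite <- (hom_interchange _ _ _ _ _ _ _ _ _ _ h1 (idm_hom _) (idm_hom _) h2).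
  rewrite (hom_idl _ _ _ h1), (hom_idr _ _ _ h2); reflexivity.
Qed.

(** Sorting preserves [eval], so agreement of the sorted lists, checked by computation, suffices for
    equality of morphisms. *)
Lemma reifies_eq f g s s' t t' ls ms : reifies f s ls t ->
  reifies g s' ms t' -> s = s' -> sort ls = sort ms -> f = g.
Proof.
  intros [Hf ->] [Hg ->] <- E.
  rewrite <- (proj2 (sort_correct _ _ _ Hf)), E.
  apply (sort_correct _ _ _ Hg).
Qed.

Lemma reifies_hom A B f s t s' t' ls : reifies f s ls t ->
  A = obj s' -> B = obj t' -> s = s' -> t = t' -> is_hom A B f.
Proof. intros [Hf ->] -> -> <- <-; exact (eval_hom _ _ _ Hf). Qed.

Lemma obj_unit : unitob = obj [].
Proof. reflexivity. Qed.

Lemma obj_single A : A = obj [A].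
Proof. symmetry; apply tensO1r. Qed.

Lemma obj_tens A B s t : A = obj s -> B = obj t -> A ⊠ B = obj (s ++ t).
Proof. intros -> ->; symmetry; apply obj_app. Qed.

End Diagrams.

Create HintDb homs discriminated.
Global Hint Resolve braid_hom braid_inv_hom coev_hom ev_hom : homs.

Ltac obj_list :=
  lazymatch goal with
  | |- _ ⊠ _ = _ => eapply obj_tens; obj_list
  | |- unitob = _ => exact obj_unit
  | |- _ => apply obj_single
  end.

(** Anything that is not a composite, a tensor product or an identity becomes a generator, typed by
    a hypothesis or by [homs]. *)
Ltac reify :=
  lazymatch goal with
  | |- reifies (_ ∘ _) _ _ _ => eapply reifies_comp; [reify | reify | reflexivity]
  | |- reifies (_ ⊗ _) _ _ _ => eapply reifies_tens; [reify | reify]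
  | |- reifies (idm _) _ _ _ => eapply reifies_idm; obj_list
  | |- _ => eapply reifies_gen; [solve [eauto with homs] | obj_list | obj_list]
  end.

(* Proves equalities that follow from the axioms of a strict monoidal category,
   the generating morphisms being treated as black boxes. *)
Ltac diagram :=
  eapply reifies_eq; [reify | reify | reflexivity | reflexivity].

Ltac hom := eapply reifies_hom; [reify | obj_list | obj_list | reflexivity | reflexivity].

(** * Braidings *)

Section Braidings.
Context {C : strict_braided_cat}.
Implicit Types (A B X Y : Ob C) (f g : Mor C).

(** The section [e'] makes [e] a split epimorphism. *)
Lemma comp_cancel_r A B f g e e' : is_hom A B e -> is_hom B A e' ->
  e ∘ e' = B -> src f = B -> src g = B -> f ∘ e = g ∘ e -> f = g.
Proof.
  intros He He' E Hf Hg Efg.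
  rewrite <- (hom_idr _ _ f (conj Hf eq_refl)), <- E.
  rewrite <- (hom_idr _ _ g (conj Hg eq_refl)), <- E.
  assert (hf : is_hom B (tgt f) f) by (split; auto).
  assert (hg : is_hom B (tgt g) g) by (split; auto).
  rewrite (hom_assoc _ _ _ _ _ _ _ He' He hf), (hom_assoc _ _ _ _ _ _ _ He' He hg).
  congruence.
Qed.

Lemma braid_nat_hom X Y X' Y' f g : is_hom X Y f -> is_hom X' Y' g ->
  braid Y Y' ∘ (f ⊗ g) = (g ⊗ f) ∘ braid X X'.
Proof. intros [<- <-] [<- <-]; apply braid_nat. Qed.

Lemma braid_natl X Y A f : is_hom X Y f -> braid Y A ∘ (f ⊗ A) = (A ⊗ f) ∘ braid X A.
Proof.
  intros [<- <-]; pose proof (braid_nat f (idm A)) as E.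
  rewrite tgt_idm, src_idm in E; exact E.
Qed.

Lemma braid_natr X Y A f : is_hom X Y f -> braid A Y ∘ (A ⊗ f) = (f ⊗ A) ∘ braid A X.
Proof.
  intros [<- <-]; pose proof (braid_nat (idm A) f) as E.
  rewrite tgt_idm, src_idm in E; exact E.
Qed.

(** The hexagon at two copies of the unit makes this braiding idempotent; being invertible, it is
    the identity. *)
Lemma braid_unitr A : braid A unitob = idm A.
Proof.
  pose proof (braid_hom A (@unitob C)) as Hb.
  rewrite tensO1l, tensO1r in Hb.
  apply (comp_cancel_r A A _ _ (braid A unitob) (braid_inv A unitob)).
  - exact Hb.
  - pose proof (braid_inv_hom A (@unitob C)) as H.
    rewrite tensO1l, tensO1r in H; exact H.
  - rewrite braid_invK, tensO1l; reflexivity.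
  - apply Hb.
  - apply src_idm.
  - pose proof (braid_tensr A unitob unitob) as E.
    rewrite tens1l, tens1r, tensO1l in E.
    rewrite <- E, (hom_idl _ _ _ Hb); reflexivity.
Qed.

Lemma braid_unitl A : braid unitob A = idm A.
Proof.
  pose proof (braid_hom (@unitob C) A) as Hb.
  rewrite tensO1l, tensO1r in Hb.
  apply (comp_cancel_r A A _ _ (braid unitob A) (braid_inv unitob A)).
  - exact Hb.
  - pose proof (braid_inv_hom (@unitob C) A) as H.
    rewrite tensO1l, tensO1r in H; exact H.
  - rewrite braid_invK, tensO1r; reflexivity.
  - apply Hb.
  - apply src_idm.
  - pose proof (braid_tensl unitob unitob A) as E.
    rewrite tens1l, tens1r, tensO1l in E.
    rewrite <- E, (hom_idl _ _ _ Hb); reflexivity.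
Qed.

Lemma braid_scalarl X A f : is_hom X unitob f -> (A ⊗ f) ∘ braid X A = f ⊗ A.
Proof.
  intros Hf; rewrite <- (braid_natl _ _ A f Hf), braid_unitl.
  diagram.
Qed.

Lemma braid_scalarr X A f : is_hom X unitob f -> (f ⊗ A) ∘ braid A X = A ⊗ f.
Proof.
  intros Hf; rewrite <- (braid_natr _ _ A f Hf), braid_unitr.
  diagram.
Qed.

End Braidings.

(** * Duality *)

Section Duality.
Context {C : strict_braided_cat} {P : Ob C} (F : finite P).

Definition uncurry (f : Mor C) : Mor C := (ev F ⊗ P) ∘ (P ⊗ f).

(** A triangle identity recovers [h] from [uncurry h] by bending the strand of [P] back with
    [coev F]. *)
Lemma uncurry_inj X f g :
  is_hom X (dual F ⊠ P) f -> is_hom X (dual F ⊠ P) g ->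
  uncurry f = uncurry g -> f = g.
Proof.
  assert (E : forall h, is_hom X (dual F ⊠ P) h ->
    h = (dual F ⊗ uncurry h) ∘ (coev F ⊗ X)).
  { intros h Hh; unfold uncurry.
    transitivity ((((dual F ⊗ ev F) ∘ (coev F ⊗ dual F)) ⊗ P) ∘ h);
      [rewrite ev_coev_r|]; diagram. }
  intros Hf Hg Efg; rewrite (E f Hf), (E g Hg), Efg; reflexivity.
Qed.

(** The other triangle identity; with [e] a counit, the convolution unit becomes the trivial
    action. *)
Lemma uncurry_coev X e : is_hom X unitob e -> uncurry (coev F ∘ e) = P ⊗ e.
Proof.
  intros He; unfold uncurry.
  transitivity (((ev F ⊗ P) ∘ (P ⊗ coev F)) ∘ (P ⊗ e));
    [|rewrite ev_coev_l]; diagram.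
Qed.

(* Under uncurrying, [P* ⊗ P] acts on [P] from the right. *)
Lemma uncurry_conv X d f g : is_hom X (X ⊠ X) d ->
  is_hom X (dual F ⊠ P) f -> is_hom X (dual F ⊠ P) g ->
  uncurry ((dual F ⊗ ev F ⊗ P) ∘ (f ⊗ g) ∘ d)
  = uncurry g ∘ (uncurry f ⊗ X) ∘ (P ⊗ d).
Proof. intros Hd Hf Hg; unfold uncurry; diagram. Qed.

(** Precomposing with the braiding turns right actions into left ones. The swap of the two factors
    that this costs is supplied by [s], which is [T H] in the application. *)
Lemma uncurry_conv_braid X d f g phi psi s d' :
  is_hom X (X ⊠ X) d -> is_hom X (X ⊠ X) d' -> is_hom X X s ->
  is_hom X (dual F ⊠ P) f -> is_hom X (dual F ⊠ P) g ->
  is_hom (X ⊠ P) P phi -> is_hom (X ⊠ P) P psi ->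
  uncurry f ∘ braid X P = phi -> uncurry g ∘ braid X P = psi ->
  d ∘ s = braid X X ∘ d' ->
  uncurry ((dual F ⊗ ev F ⊗ P) ∘ (f ⊗ g) ∘ d) ∘ (braid X P ∘ (s ⊗ P))
  = psi ∘ (X ⊗ phi) ∘ (d' ⊗ P).
Proof.
  intros Hd Hd' Hs Hf Hg Hphi Hpsi Ef Eg Ed.
  rewrite (uncurry_conv X) by assumption.
  assert (Hf' : is_hom (P ⊠ X) P (uncurry f)) by (unfold uncurry; hom).
  assert (Hg' : is_hom (P ⊠ X) P (uncurry g)) by (unfold uncurry; hom).
  transitivity (uncurry g ∘ (uncurry f ⊗ X) ∘ ((P ⊗ d) ∘ braid X P) ∘ (s ⊗ P));
    [diagram|].
  rewrite <- (braid_natl _ _ P _ Hd), braid_tensl.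
  transitivity (uncurry g ∘ ((uncurry f ∘ braid X P) ⊗ X) ∘ (X ⊗ braid X P)
    ∘ ((d ∘ s) ⊗ P)); [diagram|].
  rewrite Ef, Ed.
  transitivity (uncurry g ∘ ((phi ⊗ X)
    ∘ ((X ⊗ braid X P) ∘ (braid X X ⊗ P))) ∘ (d' ⊗ P)); [diagram|].
  (* The [braid X X] coming from [d ∘ s] completes a hexagon, so [phi] can pass through the
     braiding. *)
  rewrite <- braid_tensr, <- (braid_natr _ _ X _ Hphi).
  rewrite <- Eg; diagram.
Qed.

End Duality.

(** * Convolution *)

Global Hint Resolve alg_unit_hom alg_mul_hom coalg_counit_hom coalg_comul_hom
  : homs.

(** A left and a right inverse of [g] agree: [f = f * (g * h) = (f * g) * h = h], with [*] the
    convolution. *)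
Lemma conv_inverse_unique (C : strict_braided_cat) (D : coalg_data C)
  (A : alg_data C) f g h : is_coalgebra D -> is_algebra A ->
  is_hom D A f -> is_hom D A g -> is_hom D A h ->
  conv D A f g = alg_unit A ∘ coalg_counit D ->
  conv D A g h = alg_unit A ∘ coalg_counit D -> f = h.
Proof.
  intros HD HA Hf Hg Hh; unfold conv; intros Efg Egh.
  transitivity (alg_mul A ∘ (f ⊗ (alg_unit A ∘ coalg_counit D)) ∘ coalg_comul D).
  { transitivity ((alg_mul A ∘ (A ⊗ alg_unit A)) ∘ f
      ∘ ((D ⊗ coalg_counit D) ∘ coalg_comul D)); [|diagram].
    rewrite alg_mul1r, coalg_comul1r by assumption; diagram. }
  rewrite <- Egh.
  transitivity ((alg_mul A ∘ (A ⊗ alg_mul A)) ∘ (f ⊗ g ⊗ h)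
    ∘ ((D ⊗ coalg_comul D) ∘ coalg_comul D)); [diagram|].
  rewrite alg_mulA, coalg_comulA by assumption.
  transitivity (alg_mul A ∘ ((alg_mul A ∘ (f ⊗ g) ∘ coalg_comul D) ⊗ h)
    ∘ coalg_comul D); [diagram|].
  rewrite Efg.
  transitivity ((alg_mul A ∘ (alg_unit A ⊗ A)) ∘ h
    ∘ ((coalg_counit D ⊗ D) ∘ coalg_comul D)); [diagram|].
  rewrite alg_mul1l, coalg_comul1l by assumption; diagram.
Qed.

Lemma tens_is_coalgebra (C : strict_braided_cat) (D E : coalg_data C) :
  is_coalgebra D -> is_coalgebra E -> is_coalgebra (tens_coalg D E).
Proof.
  intros HD HE.
  assert (hD : is_hom D (D ⊠ D) (coalg_comul D)) by eauto with homs.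
  assert (hE : is_hom E (E ⊠ E) (coalg_comul E)) by eauto with homs.
  assert (eD : is_hom D unitob (coalg_counit D)) by eauto with homs.
  assert (eE : is_hom E unitob (coalg_counit E)) by eauto with homs.
  split; cbn; [hom | hom | | |].
  (* Coassociativity: pull the coproduct of [D] through the braiding, use coassociativity of both
     factors, then push the coproduct of [E] back through. *)
  - transitivity ((D ⊗ E ⊗ D ⊗ braid D E ⊗ E)
      ∘ (D ⊗ ((E ⊗ coalg_comul D) ∘ braid D E) ⊗ E ⊗ E)
      ∘ (coalg_comul D ⊗ ((E ⊗ coalg_comul E) ∘ coalg_comul E))); [diagram|].
    rewrite <- (braid_natl _ _ E _ hD), braid_tensl.
    rewrite (coalg_comulA HE).
    transitivity ((D ⊗ E ⊗ D ⊗ braid D E ⊗ E) ∘ (D ⊗ braid D E ⊗ D ⊗ E ⊗ E)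
      ∘ (D ⊗ D ⊗ braid D E ⊗ E ⊗ E)
      ∘ (((D ⊗ coalg_comul D) ∘ coalg_comul D)
          ⊗ ((coalg_comul E ⊗ E) ∘ coalg_comul E))); [diagram|].
    rewrite (coalg_comulA HD).
    transitivity ((D ⊗ braid D E ⊗ E ⊗ D ⊗ E)
      ∘ (D ⊗ D ⊗ (((E ⊗ braid D E) ∘ (braid D E ⊗ E)) ∘ (D ⊗ coalg_comul E)) ⊗ E)
      ∘ (((coalg_comul D ⊗ D) ∘ coalg_comul D) ⊗ coalg_comul E)); [diagram|].
    rewrite <- braid_tensr, (braid_natr _ _ D _ hE).
    diagram.
  - transitivity ((coalg_counit D ⊗ ((coalg_counit E ⊗ D) ∘ braid D E) ⊗ E)
      ∘ (coalg_comul D ⊗ coalg_comul E)); [diagram|].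
    rewrite (braid_scalarr _ D _ eE).
    transitivity (((coalg_counit D ⊗ D) ∘ coalg_comul D)
      ⊗ ((coalg_counit E ⊗ E) ∘ coalg_comul E)); [diagram|].
    rewrite (coalg_comul1l HD), (coalg_comul1l HE); apply tens_idm.
  - transitivity ((D ⊗ ((E ⊗ coalg_counit D) ∘ braid D E) ⊗ coalg_counit E)
      ∘ (coalg_comul D ⊗ coalg_comul E)); [diagram|].
    rewrite (braid_scalarl _ E _ eD).
    transitivity (((D ⊗ coalg_counit D) ∘ coalg_comul D)
      ⊗ ((E ⊗ coalg_counit E) ∘ coalg_comul E)); [diagram|].
    rewrite (coalg_comul1r HD), (coalg_comul1r HE); apply tens_idm.
Qed.

(** * The antipode *)

Section Antipode.
Context {C : strict_braided_cat} (H : hopf_algebra C).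

Lemma eta_hom : is_hom unitob H (eta H).
Proof. exact (alg_unit_hom (hopf_is_algebra H)). Qed.

Lemma mu_hom : is_hom (H ⊠ H) H (mu H).
Proof. exact (alg_mul_hom (hopf_is_algebra H)). Qed.

Lemma eps_hom : is_hom H unitob (eps H).
Proof. exact (coalg_counit_hom (hopf_is_coalgebra H)). Qed.

Lemma delta_hom : is_hom H (H ⊠ H) (delta H).
Proof. exact (coalg_comul_hom (hopf_is_coalgebra H)). Qed.

Hint Resolve eta_hom mu_hom eps_hom delta_hom lambda_hom : homs.

Lemma muA : mu H ∘ (H ⊗ mu H) = mu H ∘ (mu H ⊗ H).
Proof. exact (alg_mulA (hopf_is_algebra H)). Qed.

Lemma mu1l : mu H ∘ (eta H ⊗ H) = H.
Proof. exact (alg_mul1l (hopf_is_algebra H)). Qed.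

Lemma mu1r : mu H ∘ (H ⊗ eta H) = H.
Proof. exact (alg_mul1r (hopf_is_algebra H)). Qed.

Lemma deltaA : (H ⊗ delta H) ∘ delta H = (delta H ⊗ H) ∘ delta H.
Proof. exact (coalg_comulA (hopf_is_coalgebra H)). Qed.

Lemma eps_eta : eps H ∘ eta H = idm unitob.
Proof. exact (alg_morphism_unit (eps_alg_morphism H)). Qed.

Lemma eps_mu : eps H ∘ mu H = eps H ⊗ eps H.
Proof.
  pose proof (alg_morphism_mul (eps_alg_morphism H)) as E; cbn in E.
  rewrite E; diagram.
Qed.

Lemma delta_eta : delta H ∘ eta H = eta H ⊗ eta H.
Proof. exact (alg_morphism_unit (delta_alg_morphism H)). Qed.

Lemma delta_mu : delta H ∘ mu H
  = (mu H ⊗ mu H) ∘ (H ⊗ braid H H ⊗ H) ∘ (delta H ⊗ delta H).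
Proof. exact (alg_morphism_mul (delta_alg_morphism H)). Qed.

(** The unit is grouplike, so the antipode identity evaluated at it reads [λη · η = η]. *)
Lemma lambda_eta : lambda H ∘ eta H = eta H.
Proof.
  transitivity ((mu H ∘ (H ⊗ eta H)) ∘ lambda H ∘ eta H);
    [rewrite mu1r; diagram|].
  transitivity (mu H ∘ (lambda H ⊗ H) ∘ (eta H ⊗ eta H)); [diagram|].
  rewrite <- delta_eta.
  transitivity ((mu H ∘ (lambda H ⊗ H) ∘ delta H) ∘ eta H); [diagram|].
  rewrite antipode_l.
  transitivity (eta H ∘ (eps H ∘ eta H)); [diagram|].
  rewrite eps_eta; diagram.
Qed.

(* Both sides are convolution inverses of [mu H] in [Hom (H ⊠ H, H)]. *)
Lemma lambda_mu :
  lambda H ∘ mu H = mu H ∘ braid H H ∘ (lambda H ⊗ lambda H).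
Proof.
  apply (conv_inverse_unique C (tens_coalg (hopf_coalg H) (hopf_coalg H))
    (AlgData (hopf_obj H) (eta H) (mu H)) _ (mu H) _); cbn.
  - apply tens_is_coalgebra; exact (hopf_is_coalgebra H).
  - apply hopf_is_algebra.
  - hom.
  - hom.
  - hom.
  (* As [mu H] respects coproducts, this convolution is that of [lambda H] with the identity,
     precomposed with [mu H]. *)
  - unfold conv; cbn.
    transitivity (mu H ∘ (lambda H ⊗ H) ∘ ((mu H ⊗ mu H)
      ∘ (H ⊗ braid H H ⊗ H) ∘ (delta H ⊗ delta H))); [diagram|].
    rewrite <- delta_mu, <- eps_mu.
    transitivity ((mu H ∘ (lambda H ⊗ H) ∘ delta H) ∘ mu H); [diagram|].
    rewrite antipode_l; diagram.
  (* The antipode pair of the second tensor factor is innermost and collapses first; its counit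
     passes the braiding, and then the pair of the first factor collapses. *)
  - unfold conv; cbn.
    transitivity ((mu H ∘ (mu H ⊗ H)) ∘ (H ⊗ H ⊗ (mu H ∘ (braid H H
      ∘ (lambda H ⊗ lambda H)))) ∘ (H ⊗ braid H H ⊗ H) ∘ (delta H ⊗ delta H));
      [diagram|].
    rewrite (braid_nat_hom _ _ _ _ _ _ (lambda_hom H) (lambda_hom H)), <- muA.
    transitivity (mu H ∘ (H ⊗ (mu H ∘ (H ⊗ mu H))) ∘ (H ⊗ H ⊗ lambda H ⊗ lambda H)
      ∘ (H ⊗ ((H ⊗ braid H H) ∘ (braid H H ⊗ H) ∘ (H ⊗ delta H)))
      ∘ (delta H ⊗ H)); [diagram|].
    rewrite <- braid_tensr, (braid_natr _ _ _ _ delta_hom), muA.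
    transitivity (mu H ∘ (H ⊗ mu H)
      ∘ (H ⊗ (mu H ∘ (H ⊗ lambda H) ∘ delta H) ⊗ lambda H)
      ∘ (H ⊗ braid H H) ∘ (delta H ⊗ H)); [diagram|].
    rewrite antipode_r.
    transitivity (mu H ∘ (H ⊗ (mu H ∘ (eta H ⊗ H))) ∘ (H ⊗ lambda H)
      ∘ (H ⊗ ((eps H ⊗ H) ∘ braid H H)) ∘ (delta H ⊗ H)); [diagram|].
    rewrite mu1l, (braid_scalarr _ _ _ eps_hom).
    transitivity ((mu H ∘ (H ⊗ lambda H) ∘ delta H) ⊗ eps H); [diagram|].
    rewrite antipode_r; diagram.
Qed.

End Antipode.

Global Hint Resolve eta_hom mu_hom eps_hom delta_hom lambda_hom : homs.

(** * Brace triples *)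

Section BraceTriples.
Context {C : strict_braided_cat} (H : brace_triple C).

Lemma gamma_hom : is_hom (H ⊠ H) H (gamma H).
Proof.
  exact (coalg_morphism_hom (gamma_coalg_morphism (brace_tripleP H))).
Qed.

Lemma T_hom : is_hom H H (T H).
Proof. exact (inverse_hom (T_iso (brace_tripleP H))). Qed.

Lemma T_inv_hom : is_hom H H (T_inv H).
Proof. exact (inverse_inv_hom (T_iso (brace_tripleP H))). Qed.

Lemma lambda_inv_hom : is_hom H H (lambda_inv H).
Proof. exact (inverse_inv_hom (lambda_iso (brace_tripleP H))). Qed.

Hint Resolve gamma_hom T_hom T_inv_hom lambda_inv_hom : homs.

Lemma mu_gamma_T_r :
  mu H ∘ (H ⊗ gamma H) ∘ (delta H ⊗ T H) ∘ delta H = eta H ∘ eps H.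
Proof.
  transitivity (mu H ∘ (H ⊗ (gamma H ∘ (H ⊗ T H)))
    ∘ ((delta H ⊗ H) ∘ delta H)); [diagram|].
  rewrite <- deltaA.
  transitivity (mu H ∘ (H ⊗ (gamma H ∘ (H ⊗ T H) ∘ delta H)) ∘ delta H);
    [diagram|].
  rewrite (gamma_T_r (brace_tripleP H)); apply antipode_r.
Qed.

Lemma mu_gamma_T_l :
  mu H ∘ (H ⊗ gamma H) ∘ ((delta H ∘ T H) ⊗ H) ∘ delta H = eta H ∘ eps H.
Proof.
  rewrite (mu_gamma_delta_T (brace_tripleP H)).
  transitivity (mu H ∘ (T H ⊗ (gamma H ∘ (T H ⊗ H)))
    ∘ ((delta H ⊗ H) ∘ delta H)); [diagram|].
  rewrite <- deltaA.
  transitivity (mu H ∘ (T H ⊗ (gamma H ∘ (T H ⊗ H) ∘ delta H)) ∘ delta H);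
    [diagram|].
  rewrite (gamma_T_l (brace_tripleP H)).
  set (y := mu H ∘ _ ∘ _).
  assert (Hy : is_hom H H y) by (subst y; hom).
  destruct (lambda_iso (brace_tripleP H)) as [_ _ Ll Lr].
  (* The antipode is invertible, so [y] may be computed after applying it: it cancels [lambda_inv H]
     and reverses the product, and the resulting braiding is absorbed by [delta_T]. *)
  assert (E : lambda H ∘ y = eta H ∘ eps H).
  { subst y.
    transitivity ((lambda H ∘ mu H) ∘ (H ⊗ lambda_inv H) ∘ (T H ⊗ T H)
      ∘ delta H); [diagram|].
    rewrite lambda_mu.
    transitivity (mu H ∘ (braid H H ∘ (lambda H ⊗ (lambda H ∘ lambda_inv H)))
      ∘ (T H ⊗ T H) ∘ delta H); [diagram|].
    rewrite Lr, (braid_natl _ _ _ _ (lambda_hom H)).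
    transitivity (mu H ∘ (H ⊗ lambda H) ∘ (braid H H ∘ (T H ⊗ T H) ∘ delta H));
      [diagram|].
    rewrite <- (delta_T (brace_tripleP H)).
    transitivity ((mu H ∘ (H ⊗ lambda H) ∘ delta H) ∘ T H); [diagram|].
    rewrite antipode_r.
    transitivity (eta H ∘ (eps H ∘ T H)); [diagram|].
    rewrite (eps_T (brace_tripleP H)); reflexivity. }
  transitivity ((lambda_inv H ∘ lambda H) ∘ y); [rewrite Ll; diagram|].
  transitivity (lambda_inv H ∘ (lambda H ∘ y)); [diagram|].
  (* Writing the unit as [lambda H ∘ eta H] shows that [lambda_inv H] fixes it. *)
  rewrite E, <- lambda_eta at 1.
  transitivity ((lambda_inv H ∘ lambda H) ∘ eta H ∘ eps H); [diagram|].
  rewrite Ll; diagram.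
Qed.

(** Axiom (iv) merges the two actions into one, by a product that [mu_gamma_T_r] reduces to the
    unit, which acts trivially. *)
Lemma gamma_gamma_T_r :
  gamma H ∘ (H ⊗ gamma H) ∘ (((H ⊗ T H) ∘ delta H) ⊗ H) = eps H ⊗ H.
Proof.
  rewrite (gamma_gamma (brace_tripleP H)).
  transitivity (gamma H
    ∘ ((mu H ∘ (H ⊗ gamma H) ∘ (delta H ⊗ T H) ∘ delta H) ⊗ H)); [diagram|].
  rewrite mu_gamma_T_r.
  transitivity ((gamma H ∘ (eta H ⊗ H)) ∘ (eps H ⊗ H)); [diagram|].
  rewrite (gamma_eta (brace_tripleP H)); diagram.
Qed.

Lemma gamma_gamma_T_l :
  gamma H ∘ (H ⊗ gamma H) ∘ (((T H ⊗ H) ∘ delta H) ⊗ H) = eps H ⊗ H.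
Proof.
  rewrite (gamma_gamma (brace_tripleP H)).
  transitivity (gamma H
    ∘ ((mu H ∘ (H ⊗ gamma H) ∘ ((delta H ∘ T H) ⊗ H) ∘ delta H) ⊗ H));
    [diagram|].
  rewrite mu_gamma_T_l.
  transitivity ((gamma H ∘ (eta H ⊗ H)) ∘ (eps H ⊗ H)); [diagram|].
  rewrite (gamma_eta (brace_tripleP H)); diagram.
Qed.

(** * Convolution invertibility of [alpha] *)

Context (F : finite H).

Lemma alpha_hom : is_hom H (dual F ⊠ H) (alpha F).
Proof. unfold alpha; hom. Qed.

Hint Resolve alpha_hom : homs.

Lemma beta_hom : is_hom H (dual F ⊠ H) (beta F).
Proof. unfold beta; hom. Qed.

Hint Resolve beta_hom : homs.

(** The two braidings assemble into the one of [H] past [H ⊠ dual F], which disappears against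
    [ev F]; a triangle identity then removes [coev F]. *)
Lemma uncurry_alpha : uncurry F (alpha F) ∘ braid H H = gamma H.
Proof.
  unfold uncurry, alpha.
  assert (Hc := coev_hom F).
  transitivity (gamma H ∘ (((ev F ⊗ H) ∘ (H ⊗ braid H (dual F))) ⊗ H)
    ∘ ((H ⊗ H ⊗ coev F) ∘ braid H H)); [diagram|].
  transitivity (gamma H ∘ (((ev F ⊗ H) ∘ ((H ⊗ braid H (dual F))
    ∘ (braid H H ⊗ dual F))) ⊗ H) ∘ (H ⊗ H ⊗ coev F)); [diagram|].
  rewrite <- braid_tensr, (braid_scalarr _ _ _ (ev_hom F)).
  transitivity (gamma H ∘ (H ⊗ ((ev F ⊗ H) ∘ (H ⊗ coev F)))); [diagram|].
  rewrite ev_coev_l; diagram.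
Qed.

Lemma uncurry_beta :
  uncurry F (beta F) ∘ braid H H = gamma H ∘ (T_inv H ⊗ H).
Proof.
  unfold beta; rewrite <- uncurry_alpha; unfold uncurry.
  transitivity ((ev F ⊗ H) ∘ (H ⊗ alpha F) ∘ ((H ⊗ T_inv H) ∘ braid H H));
    [diagram|].
  rewrite <- (braid_natl _ _ _ _ T_inv_hom); diagram.
Qed.

(** Uncurrying is injective and [braid H H ∘ (T H ⊗ H)] is invertible, so equality with the
    convolution unit can be tested on left actions. *)
Lemma eq_conv_unit f : is_hom H (dual F ⊠ H) f ->
  uncurry F f ∘ (braid H H ∘ (T H ⊗ H)) = eps H ⊗ H -> f = coev F ∘ eps H.
Proof.
  intros Hf E; apply (uncurry_inj F H); [exact Hf | hom |].
  destruct (T_iso (brace_tripleP H)) as [_ _ _ Tr].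
  apply (comp_cancel_r (H ⊠ H) (H ⊠ H) _ _ (braid H H ∘ (T H ⊗ H))
    ((T_inv H ⊗ H) ∘ braid_inv H H)); [hom | hom | | | |].
  - transitivity (braid H H ∘ ((T H ∘ T_inv H) ⊗ H) ∘ braid_inv H H); [diagram|].
    rewrite Tr, <- (braid_invK H H); diagram.
  (* The source is read off a full typing, whose target [H] has to be supplied. *)
  - unfold uncurry; apply (fun h => proj1 (h : is_hom _ H _)); hom.
  - unfold uncurry; apply (fun h => proj1 (h : is_hom _ H _)); hom.
  - rewrite E, (uncurry_coev F H) by apply eps_hom.
    transitivity (((H ⊗ eps H) ∘ braid H H) ∘ (T H ⊗ H)); [|diagram].
    rewrite (braid_scalarl _ _ _ (eps_hom H)), <- (eps_T (brace_tripleP H)) at 1.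
    diagram.
Qed.

Lemma conv_alpha_beta :
  (dual F ⊗ ev F ⊗ H) ∘ (alpha F ⊗ beta F) ∘ delta H = coev F ∘ eps H.
Proof.
  destruct (T_iso (brace_tripleP H)) as [_ _ Tl _].
  apply eq_conv_unit; [hom|].
  (* By [delta_T], the choice [s = T H] forces [d' = (T H ⊗ T H) ∘ delta H]; the [T_inv H] of [beta]
     then cancels one of the two copies of [T H], here the first. *)
  erewrite (uncurry_conv_braid F H (delta H) _ _ _ _ _
    ((T H ⊗ T H) ∘ delta H)); try exact uncurry_alpha; try exact uncurry_beta;
    eauto with homs; try hom.
  - transitivity (gamma H ∘ (H ⊗ gamma H)
      ∘ ((((T_inv H ∘ T H) ⊗ T H) ∘ delta H) ⊗ H)); [diagram|].
    rewrite Tl; apply gamma_gamma_T_r.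
  - rewrite (delta_T (brace_tripleP H)); diagram.
Qed.

Lemma conv_beta_alpha :
  (dual F ⊗ ev F ⊗ H) ∘ (beta F ⊗ alpha F) ∘ delta H = coev F ∘ eps H.
Proof.
  destruct (T_iso (brace_tripleP H)) as [_ _ Tl _].
  apply eq_conv_unit; [hom|].
  (* Now [beta] acts first, so [T_inv H] cancels the second copy of [T H]. *)
  erewrite (uncurry_conv_braid F H (delta H) _ _ _ _ _
    ((T H ⊗ T H) ∘ delta H)); try exact uncurry_alpha; try exact uncurry_beta;
    eauto with homs; try hom.
  - transitivity (gamma H ∘ (H ⊗ gamma H)
      ∘ (((T H ⊗ (T_inv H ∘ T H)) ∘ delta H) ⊗ H)); [diagram|].
    rewrite Tl; apply gamma_gamma_T_l.
  - rewrite (delta_T (brace_tripleP H)); diagram.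
Qed.

End BraceTriples.

Theorem theorem3p6 (C : strict_braided_cat) (H : brace_triple C) (F : finite H) :
  is_conv_inverse (hopf_coalg H) (end_alg F) (alpha F) (beta F) /\
  (dual F ⊗ ev F ⊗ H) ∘ (alpha F ⊗ beta F) ∘ delta H = eps H ⊗ coev F /\
  (dual F ⊗ ev F ⊗ H) ∘ (beta F ⊗ alpha F) ∘ delta H = eps H ⊗ coev F.
Proof.
  (* The target of [eps H] and the source of [coev F] are the strict unit, so tensoring the two is
     composing them. *)
  assert (E : eps H ⊗ coev F = coev F ∘ eps H).
  { pose proof (eps_hom H); diagram. }
  rewrite E; split; [split|split].
  - apply alpha_hom.
  - apply beta_hom.
  - apply conv_alpha_beta.
  - apply conv_beta_alpha.
  - apply conv_alpha_beta.
  - apply conv_beta_alpha.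
Qed.
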